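(* Let $\gamma=2+\frac1m$ with $m\in\mathbb N$, $m\ge 1$. There exists $A=A(\gamma)>0$ such that, for the homogeneous nonlinearities $$\mathcal C_0(\psi)=\frac{\gamma-2}{\gamma-1}\sqrt{A}\,\psi^{\frac{\gamma-1}{\gamma-2}},\qquad \mathcal H_0'(\psi)=\psi^{\frac{\gamma+2}{\gamma-2}},$$ the ordinary differential equation on $r>0$ $$-\frac1r\partial_r\Big(\frac1r\partial_r\psi\Big)=\frac{\mathcal C_0(\psi)\,\mathcal C_0'(\psi)}{r^2}-\mathcal H_0'(\psi)$$ admits a solution $\psi_*(r)$ which is a bell shaped, $\mathcal C^\infty$, non negative profile with self-similar decay at infinity: there is a constant $C(\gamma)>0$ such that $$\psi_*(r)= C(\gamma)\,[1+o(1)]\,r^{2-\gamma}\qquad\text{as } r\to+\infty .$$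
   Context: Here $\mathcal C_0'$ denotes the derivative of $\mathcal C_0$ with respect to $\psi$. ''Bell shaped'' means that $\psi_*$ is non trivial, vanishes at $r=0$ (in fact $\psi_*=r^2\Psi_*$ with $\Psi_*$ a smooth function of $r^2$ with $\Psi_*(0)\neq0$), and that $\psi_*'$ vanishes exactly once on $(0,+\infty)$ (increasing, then decreasing to $0$). *)

(* Defs.v *)
From Stdlib Require Import Reals.
From Coquelicot Require Import Coquelicot.
Open Scope R_scope.

(* Real power [x ^ a] for [x >= 0] and [a > 0].  Stdlib's [Rpower] does not have
   [0 ^ a = 0] (it gives [Rpower 0 a = 1]).  The extension by [0] to negative [x]
   makes the two-sided derivative at [0] the right one when [a > 1]. *)
Definition rpow (x a : R) : R :=
  if Rle_dec x 0 then 0 else Rpower x a.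

Definition C0 (gamma A psi : R) : R :=
  (gamma - 2) / (gamma - 1) * sqrt A * rpow psi ((gamma - 1) / (gamma - 2)).

Definition H0' (gamma psi : R) : R :=
  rpow psi ((gamma + 2) / (gamma - 2)).

(* [C^infty] on a possibly non-open set [D]: [f] agrees on [D] with a function
   that is smooth on an open neighbourhood of [D]. *)
Definition smooth_on (D : R -> Prop) (f : R -> R) : Prop :=
  exists (U : R -> Prop) (g : R -> R),
    open U /\
    (forall x, D x -> U x /\ g x = f x) /\
    (forall (n : nat) (x : R), U x -> ex_derive_n g n x).

Definition nonneg_line (r : R) : Prop := 0 <= r.

Definition solves_ode (gamma A : R) (psi : R -> R) : Prop :=
  forall r : R, 0 < r ->
    - (1 / r * Derive (fun s => 1 / s * Derive psi s) r)
    = C0 gamma A (psi r) * Derive (C0 gamma A) (psi r) / r ^ 2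
      - H0' gamma (psi r).

Definition bell_shaped (psi : R -> R) : Prop :=
  (exists r : R, 0 < r /\ psi r <> 0) /\
  psi 0 = 0 /\
  (exists F : R -> R,
     smooth_on nonneg_line F /\ F 0 <> 0 /\
     forall r : R, 0 <= r -> psi r = r ^ 2 * F (r ^ 2)) /\
  (exists r0 : R,
     unique (fun r => 0 < r /\ Derive psi r = 0) r0 /\
     (forall r s : R, 0 <= r -> r < s -> s <= r0 -> psi r < psi s) /\
     (forall r s : R, r0 <= r -> r < s -> psi s < psi r) /\
     is_lim psi p_infty 0).

Definition self_similar_decay (gamma : R) (psi : R -> R) : Prop :=
  exists C : R, 0 < C /\
  exists o : R -> R, is_lim o p_infty 0 /\
    forall r : R, 0 < r -> psi r = C * (1 + o r) * Rpower r (2 - gamma).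

(* Main.v *)
(* In the variable t = r^2 the equation reads
   -4 psi'' = B psi^(2m+1) / t - psi^(4m+1) with B = A / (m+1).  Put
   b = 1 / (2m), N = 2m+1 and psi = t^(-b) w(ln t).  The Emden-Fowler equation
   for w has the nonlinearities w^(2m+1) and w^(4m+1), so one can look
   for solutions of w' = w (1 + b - k w^(2m)), which is logistic for w^(2m).
   These exist exactly for k = 1 / (2 sqrt N) and B = 4 (m+1) / sqrt N.
   The resulting profile is explicit:
   psi = c t (1 + t^N)^(-b) with c^(2m) = 2 b N sqrt N. *)
Require Import Defs.
From Stdlib Require Import Reals Lra Lia.
From Coquelicot Require Import Coquelicot.
Open Scope R_scope.

(** * Smoothness through a class of functions closed under differentiation *)

Inductive elementary (U : R -> Prop) : (R -> R) -> Prop :=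
| elementary_const a : elementary U (fun _ => a)
| elementary_id : elementary U (fun x => x)
| elementary_plus f g :
    elementary U f -> elementary U g -> elementary U (fun x => f x + g x)
| elementary_mult f g :
    elementary U f -> elementary U g -> elementary U (fun x => f x * g x)
| elementary_Rpower f a :
    elementary U f -> (forall x, U x -> 0 < f x) ->
    elementary U (fun x => Rpower (f x) a).

Lemma elementary_pow (U : R -> Prop) (f : R -> R) (n : nat) :
  elementary U f -> elementary U (fun x => f x ^ n).
Proof.
  intros Hf; induction n as [|n IH]; simpl.
  - apply elementary_const.
  - now apply elementary_mult.
Qed.

Lemma is_derive_Rpower (f : R -> R) (a x l : R) :
  0 < f x -> is_derive f x l ->
  is_derive (fun y => Rpower (f y) a) x (a * l * Rpower (f x) (a - 1)).
Proof.
  intros Hpos Hf; unfold Rpower.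
  assert (Hd : ex_derive f x) by (now exists l).
  auto_derive; [now repeat split|].
  replace (Derive (fun y => f y) x) with l
    by (symmetry; now apply is_derive_unique).
  replace ((a - 1) * ln (f x)) with (a * ln (f x) + - ln (f x)) by ring.
  rewrite exp_plus, exp_Ropp, exp_ln by assumption.
  field; lra.
Qed.

(** Differentiation never leaves the class: the power rule only shifts the exponent of [Rpower], and
    the base keeps the positivity recorded by its constructor. Iterating this gives derivatives of
    every order without a formula for the n-th one. *)
Lemma elementary_derive (U : R -> Prop) (f : R -> R) :
  elementary U f ->
  exists g, elementary U g /\ forall x, U x -> is_derive f x (g x).
Proof.
  induction 1 as [a| |f g Hf [f' [Ef Df]] Hg [g' [Eg Dg]]
                 |f g Hf [f' [Ef Df]] Hg [g' [Eg Dg]]|f a Hf [f' [Ef Df]] Hpos].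
  - exists (fun _ => 0); split; [apply elementary_const|].
    intros x _; auto_derive; auto.
  - exists (fun _ => 1); split; [apply elementary_const|].
    intros x _; auto_derive; auto.
  - exists (fun x => f' x + g' x); split; [now apply elementary_plus|].
    intros x Hx; apply (is_derive_plus f g); auto.
  - exists (fun x => f' x * g x + f x * g' x); split.
    + apply elementary_plus; now apply elementary_mult.
    + intros x Hx; apply (is_derive_mult f g); auto.
      intros; apply Rmult_comm.
  - exists (fun x => a * f' x * Rpower (f x) (a - 1)); split.
    + apply elementary_mult; [apply elementary_mult|];
        auto using elementary_const, elementary_Rpower.
    + intros x Hx; apply is_derive_Rpower; auto.
Qed.

Lemma elementary_ex_derive_n (U : R -> Prop) (f : R -> R) (n : nat) (x : R) :
  open U -> elementary U f -> U x -> ex_derive_n f n x.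
Proof.
  intros HU Hf Hx.
  assert (H : forall k, exists g, elementary U g /\
            forall y, U y -> Derive_n f k y = g y).
  { induction k as [|k [g [Eg Hg]]]; [now exists f|].
    destruct (elementary_derive U g Eg) as [g' [Eg' Dg]].
    exists g'; split; [assumption|]; intros y Hy; simpl.
    (* The formula [g] for the k-th derivative is known on [U] only; as [U] is open, it holds near
       [y] and can be differentiated there. *)
    rewrite (Derive_ext_loc _ g).
    - now apply is_derive_unique, Dg.
    - now apply (filter_imp U); [exact Hg|apply HU]. }
  destruct n as [|n]; [exact I|]; simpl.
  destruct (H n) as [g [Eg Hg]].
  destruct (elementary_derive U g Eg) as [g' [_ Dg]].
  apply (ex_derive_ext_loc g).
  - apply (filter_imp U); [intros y Hy; symmetry; auto|now apply HU].
  - exists (g' x); auto.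
Qed.

(** * Real and integer powers *)

Lemma Rpower_opp_inv_pow (u b : R) (n : nat) :
  0 < u -> b * INR n = 1 -> Rpower u (- b) ^ n = / u.
Proof.
  intros Hu Hb.
  rewrite <- Rpower_pow by apply exp_pos.
  rewrite Rpower_mult.
  replace (- b * INR n) with (- (1)) by lra.
  now rewrite Rpower_Ropp, Rpower_1.
Qed.

Lemma pow_S_lt_compat (x y : R) (n : nat) :
  0 <= x -> x < y -> x ^ S n < y ^ S n.
Proof.
  intros Hx Hxy; induction n as [|n IH]; [lra|].
  change (x * x ^ S n < y * y ^ S n).
  apply Rmult_le_0_lt_compat; auto using pow_le.
Qed.

Lemma rpow_INR (x : R) (n : nat) : 0 < x -> rpow x (INR n) = x ^ n.
Proof.
  intros Hx; unfold rpow.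
  destruct (Rle_dec x 0); [lra|now apply Rpower_pow].
Qed.

(** For positive arguments [rpow] is an integer power, and this set is open, so [C0] is a monomial
    near [x]. *)
Lemma Derive_C0 (gamma A x : R) (n : nat) :
  0 < x -> (gamma - 1) / (gamma - 2) = INR (S n) ->
  Derive (C0 gamma A) x
  = (gamma - 2) / (gamma - 1) * sqrt A * (INR (S n) * x ^ n).
Proof.
  intros Hx Hn; apply is_derive_unique.
  apply (is_derive_ext_loc
           (fun y => (gamma - 2) / (gamma - 1) * sqrt A * y ^ S n)).
  - apply (filter_imp (fun y => 0 < y)); [|now apply (open_gt 0)].
    intros y Hy; unfold C0; now rewrite Hn, rpow_INR.
  - evar_last; [apply is_derive_scal, is_derive_pow, is_derive_id|].
    change (Nat.pred (S n)) with n; change one with 1; now rewrite Rmult_1_r.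
Qed.

(** * The explicit profile and its derivatives in t = r^2 *)

Section Profile.

Variable m : nat.
Hypothesis hm : (1 <= m)%nat.

Definition N : nat := S (2 * m).
Definition b : R := / INR (2 * m).
Definition c : R := Rpower (2 * b * INR N * sqrt (INR N)) b.

Definition profile_factor (t : R) : R := c * Rpower (1 + t ^ N) (- b).
Definition profile (r : R) : R := r ^ 2 * profile_factor (r ^ 2).
(** First derivative of t * [profile_factor] t. The factor 1 - b t^N carries its sign, hence the
    position of the maximum. *)
Definition profile_slope (t : R) : R :=
  profile_factor t * (1 - b * t ^ N) / (1 + t ^ N).
(** Second derivative of t * [profile_factor] t, over the common denominator (1 + t^N)^2. *)
Definition profile_curvature (t : R) : R :=
  profile_factor t * INR N * t ^ (2 * m) * (b ^ 2 * t ^ N - (2 * b + 1))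
  / (1 + t ^ N) ^ 2.

Lemma INR_m_ge1 : 1 <= INR m.
Proof. now apply (le_INR 1 m). Qed.

Lemma INR_2m : INR (2 * m) = 2 * INR m.
Proof. now rewrite mult_INR. Qed.

Lemma INR_N : INR N = 2 * INR m + 1.
Proof. unfold N; now rewrite S_INR, INR_2m. Qed.

Lemma b_eq : b = / (2 * INR m).
Proof. unfold b; now rewrite INR_2m. Qed.

Lemma b_pos : 0 < b.
Proof.
  pose proof INR_m_ge1; rewrite b_eq; apply Rinv_0_lt_compat; lra.
Qed.

Lemma b_mul_2m : b * INR (2 * m) = 1.
Proof. pose proof INR_m_ge1; rewrite b_eq, INR_2m; field; lra. Qed.

Lemma c_pos : 0 < c.
Proof. apply exp_pos. Qed.

Lemma c_pow : c ^ (2 * m) = 2 * b * INR N * sqrt (INR N).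
Proof.
  pose proof INR_m_ge1; pose proof b_pos; pose proof INR_N.
  unfold c; rewrite <- Rpower_pow by apply exp_pos.
  rewrite Rpower_mult, b_mul_2m, Rpower_1; [reflexivity|].
  assert (0 < sqrt (INR N)) by (apply sqrt_lt_R0; lra).
  repeat apply Rmult_lt_0_compat; lra.
Qed.

Lemma one_plus_pow_pos (t : R) : 0 <= t -> 0 < 1 + t ^ N.
Proof. intros Ht; pose proof (pow_le t N Ht); lra. Qed.

(* [N] is odd. *)
Lemma one_plus_pow_pos_gt (t : R) : -1 < t -> 0 < 1 + t ^ N.
Proof.
  intros Ht; destruct (Rle_lt_dec 0 t) as [H|H]; [now apply one_plus_pow_pos|].
  assert (Hs : (- t) ^ N < 1).
  { apply pow_lt_1_compat; [lra|unfold N; lia]. }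
  replace t with (- (- t)) by ring.
  rewrite <- (Rmult_1_l (- t)) at 1.
  rewrite Ropp_mult_distr_l, Rpow_mult_distr.
  unfold N at 1; rewrite pow_1_odd; lra.
Qed.

Lemma profile_factor_pos (t : R) : 0 < profile_factor t.
Proof. apply Rmult_lt_0_compat; [apply c_pos|apply exp_pos]. Qed.

(** As b * 2m = 1, the power 2m turns the fractional power into a rational function of t. This
    reduces the differential equation to an algebraic identity. *)
Lemma profile_factor_pow (t : R) : 0 <= t ->
  profile_factor t ^ (2 * m) = 2 * b * INR N * sqrt (INR N) / (1 + t ^ N).
Proof.
  intros Ht; unfold profile_factor.
  rewrite Rpow_mult_distr, c_pow, Rpower_opp_inv_pow; auto using b_mul_2m.
  now apply one_plus_pow_pos.
Qed.

Lemma is_derive_one_plus_pow (t : R) :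
  is_derive (fun s => 1 + s ^ N) t (INR N * t ^ (2 * m)).
Proof.
  evar_last.
  { apply (is_derive_plus (fun _ => 1)); [apply is_derive_const|].
    apply is_derive_pow, is_derive_id. }
  change (Nat.pred N) with (2 * m)%nat; change one with 1.
  change (0 + INR N * 1 * t ^ (2 * m) = INR N * t ^ (2 * m)); ring.
Qed.

Lemma is_derive_profile_factor (t : R) : 0 <= t ->
  is_derive profile_factor t
    (- b * INR N * t ^ (2 * m) * profile_factor t / (1 + t ^ N)).
Proof.
  intros Ht; pose proof (one_plus_pow_pos t Ht) as Hu.
  unfold profile_factor.
  evar_last.
  { apply is_derive_scal, is_derive_Rpower; [exact Hu|].
    apply is_derive_one_plus_pow. }
  unfold Rminus; rewrite Rpower_plus, (Rpower_Ropp _ 1), Rpower_1 by exact Hu.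
  field; lra.
Qed.

Lemma is_derive_profile_sq (t : R) : 0 <= t ->
  is_derive (fun s => s * profile_factor s) t (profile_slope t).
Proof.
  intros Ht; pose proof (one_plus_pow_pos t Ht) as Hu.
  pose proof INR_m_ge1; pose proof b_mul_2m as Hb.
  pose proof (is_derive_profile_factor t Ht) as Hf.
  assert (Hd : ex_derive profile_factor t) by (eexists; exact Hf).
  (* From b * 2m = 1 and N = 2m + 1. It merges 1 + t^N - b N t^N into 1 - b t^N. *)
  assert (HbN : b * INR N = b + 1) by (unfold N; rewrite S_INR; lra).
  auto_derive; [now repeat split|].
  replace (Derive (fun x => profile_factor x) t)
    with (- b * INR N * t ^ (2 * m) * profile_factor t / (1 + t ^ N))
    by (symmetry; now apply is_derive_unique).
  unfold profile_slope.
  transitivity (profile_factor t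
    * (1 - b * INR N * (t * t ^ (2 * m)) / (1 + t ^ N))); [field; lra|].
  change (t * t ^ (2 * m)) with (t ^ N); rewrite HbN; field; lra.
Qed.

Lemma is_derive_profile_slope (t : R) : 0 <= t ->
  is_derive profile_slope t (profile_curvature t).
Proof.
  intros Ht; pose proof (one_plus_pow_pos t Ht) as Hu.
  unfold profile_slope.
  (* With the numerator written through 1 + s^N, the derivative of that one expression serves both
     numerator and denominator. *)
  apply (is_derive_ext
           (fun s => profile_factor s * (1 + b - b * (1 + s ^ N)) / (1 + s ^ N))).
  { intros s; now replace (1 + b - b * (1 + s ^ N)) with (1 - b * s ^ N) by ring. }
  evar_last.
  { apply is_derive_div; [| |lra]; [|apply is_derive_one_plus_pow].
    apply (is_derive_mult profile_factor); [now apply is_derive_profile_factor|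
      |intros; apply Rmult_comm].
    apply (is_derive_minus (fun _ => 1 + b)); [apply is_derive_const|].
    apply is_derive_scal, is_derive_one_plus_pow. }
  unfold profile_curvature.
  unfold minus, plus, mult, opp, zero; cbn -[pow INR Nat.mul N].
  field; lra.
Qed.

(** * Return to the variable r and verification of the equation *)

Lemma is_derive_profile (r : R) :
  is_derive profile r (2 * r * profile_slope (r ^ 2)).
Proof.
  unfold profile.
  apply (is_derive_comp (fun s => s * profile_factor s) (fun s => s ^ 2)).
  - apply is_derive_profile_sq, pow2_ge_0.
  - auto_derive; [exact I|ring].
Qed.

Lemma profile_pos (r : R) : 0 < r -> 0 < profile r.
Proof.
  intros Hr; apply Rmult_lt_0_compat; [now apply pow_lt|].
  apply profile_factor_pos.
Qed.

(** With t = r^2 the operator (1/r) d/dr is 2 d/dt: the inner one gives twice the slope, and the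
    chain rule for the outer derivative adds a factor 2r. *)
Lemma profile_second_order (r : R) : 0 < r ->
  Derive (fun s => 1 / s * Derive profile s) r
  = 4 * r * profile_curvature (r ^ 2).
Proof.
  intros Hr; apply is_derive_unique.
  apply (is_derive_ext_loc (fun s => 2 * profile_slope (s ^ 2))).
  - apply (filter_imp (fun y => 0 < y)); [|now apply (open_gt 0)].
    intros s Hs.
    rewrite (is_derive_unique _ _ _ (is_derive_profile s)).
    change (2 * profile_slope (s ^ 2) = 1 / s * (2 * s * profile_slope (s ^ 2))).
    field; lra.
  - evar_last.
    { apply is_derive_scal.
      apply (is_derive_comp profile_slope (fun s => s ^ 2)).
      - apply is_derive_profile_slope, pow2_ge_0.
      - auto_derive; [exact I|reflexivity]. }
    change (scal ?x ?y) with (x * y); simpl; ring.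
Qed.

Lemma profile_solves_ode (gamma : R) : gamma = 2 + 1 / INR m ->
  solves_ode gamma (4 * (INR m + 1) ^ 2 / sqrt (INR N)) profile.
Proof.
  intros Hg r Hr.
  pose proof INR_m_ge1 as Hm; pose proof b_eq as Hb; pose proof INR_N as HN.
  set (A := 4 * (INR m + 1) ^ 2 / sqrt (INR N)).
  assert (Hs : 0 < sqrt (INR N)) by (apply sqrt_lt_R0; lra).
  assert (HsN : sqrt (INR N) * sqrt (INR N) = INR N) by (apply sqrt_sqrt; lra).
  assert (HA : 0 <= A).
  { apply Rlt_le, Rdiv_lt_0_compat; [|exact Hs].
    apply Rmult_lt_0_compat; [lra|apply pow_lt; lra]. }
  (* Since gamma - 2 = 1/m, the exponents are the integers m + 1 and 4m + 1, and [rpow] is an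
     ordinary power at the positive value [profile r]. *)
  assert (E1 : (gamma - 1) / (gamma - 2) = INR (S m)).
  { rewrite S_INR, Hg; field; lra. }
  assert (E2 : (gamma + 2) / (gamma - 2) = INR (S (2 * m * 2))).
  { rewrite S_INR, mult_INR, INR_2m, Hg; simpl; field; lra. }
  assert (E3 : (gamma - 2) / (gamma - 1) = / (INR m + 1)).
  { rewrite Hg; field; lra. }
  pose proof (profile_pos r Hr) as Hpos.
  rewrite (Derive_C0 _ _ _ m Hpos E1), profile_second_order by exact Hr.
  unfold C0, H0'; rewrite E1, E2, E3, !rpow_INR by exact Hpos.
  (* Up to one factor [profile r], the right-hand side is a polynomial of degree two in [P], which
     is rational in r^2. *)
  set (P := profile r ^ (2 * m)).
  assert (HP : P = (r ^ 2) ^ (2 * m)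
                   * (2 * b * INR N * sqrt (INR N) / (1 + (r ^ 2) ^ N))).
  { unfold P, profile; rewrite Rpow_mult_distr, profile_factor_pow;
      [reflexivity|apply pow2_ge_0]. }
  assert (Hrhs : / (INR m + 1) * sqrt A * profile r ^ S m
            * (/ (INR m + 1) * sqrt A * (INR (S m) * profile r ^ m)) / r ^ 2
            - profile r ^ S (2 * m * 2)
          = A / (INR m + 1) * profile r * P / r ^ 2 - profile r * P ^ 2).
  { assert (EP : P = profile r ^ m * profile r ^ m)
      by (unfold P; rewrite <- pow_add; f_equal; lia).
    assert (EP2 : P ^ 2 = profile r ^ (2 * m * 2))
      by (unfold P; now rewrite <- pow_mult).
    rewrite EP2, EP, S_INR, <- !tech_pow_Rmult.
    transitivity (sqrt A * sqrt A / (INR m + 1) * profile r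
      * (profile r ^ m * profile r ^ m) / r ^ 2
      - profile r * profile r ^ (2 * m * 2)); [field; lra|].
    now rewrite sqrt_sqrt. }
  rewrite Hrhs, HP.
  unfold profile, profile_curvature, A.
  pose proof (one_plus_pow_pos (r ^ 2) (pow2_ge_0 r)) as Hu; revert Hu.
  assert (Ht : 0 < r ^ 2) by now apply pow_lt.
  set (t := r ^ 2) in *.
  change (t ^ N) with (t * t ^ (2 * m)).
  set (T := t ^ (2 * m)); intros Hu.
  set (f := profile_factor t).
  set (s := sqrt (INR N)) in *.
  (* Expressing b, N and m through s = sqrt N removes the relation s^2 = N. What remains is a
     rational identity in independent t, T, f and s. *)
  rewrite Hb, <- HsN.
  replace (INR m) with ((s * s - 1) / 2) by lra.
  field.
  repeat split; try lra; nra.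
Qed.

(** * Smoothness in r and in r^2 *)

Lemma profile_smooth : smooth_on nonneg_line profile.
Proof.
  exists (fun _ => True), profile.
  split; [apply open_true|]; split; [auto|].
  intros n x _; apply (elementary_ex_derive_n (fun _ => True));
    [apply open_true| |exact I].
  unfold profile, profile_factor.
  apply elementary_mult; [apply elementary_pow, elementary_id|].
  apply elementary_mult; [apply elementary_const|].
  apply elementary_Rpower.
  - apply elementary_plus; [apply elementary_const|].
    do 2 apply elementary_pow; apply elementary_id.
  - intros y _; apply one_plus_pow_pos, pow2_ge_0.
Qed.

(** The closed half-line needs an open neighbourhood; t > -1 serves, because the base 1 + t^N stays
    positive there. In the variable r the base 1 + (r^2)^N is positive on the whole line. *)
Lemma profile_factor_smooth : smooth_on nonneg_line profile_factor.
Proof.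
  exists (fun t => -1 < t), profile_factor.
  split; [apply open_gt|]; split.
  - unfold nonneg_line; intros x Hx; split; [lra|reflexivity].
  - intros n x Hx; apply (elementary_ex_derive_n (fun t => -1 < t));
      [apply open_gt| |exact Hx].
    apply elementary_mult; [apply elementary_const|].
    apply elementary_Rpower; [|exact one_plus_pow_pos_gt].
    apply elementary_plus; [apply elementary_const|].
    apply elementary_pow, elementary_id.
Qed.

(** * Decay at infinity *)

Lemma profile_decay (r : R) : 0 < r ->
  profile r
  = c * (1 + (Rpower (1 + / (r ^ 2) ^ N) (- b) - 1)) * Rpower r (- (2 * b)).
Proof.
  intros Hr; pose proof INR_m_ge1; pose proof b_mul_2m as Hb.
  assert (Ht : 0 < r ^ 2) by now apply pow_lt.
  assert (HT : 0 < (r ^ 2) ^ N) by now apply pow_lt.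
  pose proof (Rinv_0_lt_compat _ HT) as HI.
  unfold profile, profile_factor.
  (* The dominant term is pulled out, leaving a factor that tends to 1. *)
  replace (1 + (r ^ 2) ^ N) with ((1 + / (r ^ 2) ^ N) * (r ^ 2) ^ N)
    by (field; lra).
  rewrite <- Rpower_mult_distr by lra.
  (* Here bN = b + 1, so t^(-bN) = t^(-b) / t, and the prefactor r^2 of the profile cancels 1/t. *)
  replace (Rpower ((r ^ 2) ^ N) (- b)) with (Rpower r (- (2 * b)) * / r ^ 2).
  - field; lra.
  - rewrite <- pow_mult, <- !Rpower_pow by exact Hr.
    rewrite <- Rpower_Ropp, Rpower_mult, <- Rpower_plus; f_equal.
    rewrite INR_2m in Hb; rewrite mult_INR, INR_N; simpl (INR 2); lra.
Qed.

Lemma profile_decay_remainder :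
  is_lim (fun r => Rpower (1 + / (r ^ 2) ^ N) (- b) - 1) p_infty 0.
Proof.
  assert (H : is_lim (fun r => / (r ^ 2) ^ N) p_infty 0).
  { apply (is_lim_ext (fun r => / r ^ (2 * N)));
      [intros; now rewrite pow_mult|].
    apply (is_lim_inv _ _ p_infty).
    (* For r > 1 the power r^(2N) dominates r. *)
    - apply (is_lim_le_p_loc (fun r => r)); [|apply is_lim_id].
      exists 1; intros r Hr; rewrite <- (pow_1 r) at 1.
      apply Rle_pow; [lra|unfold N; lia].
    - discriminate. }
  apply (is_lim_comp_continuous _ (fun y => Rpower (1 + y) (- b) - 1)) in H.
  - simpl in H; rewrite Rplus_0_r in H.
    replace (Rpower 1 (- b) - 1) with 0 in H; [exact H|].
    unfold Rpower; rewrite ln_1, Rmult_0_r, exp_0; ring.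
  - apply (ex_derive_continuous (fun y => Rpower (1 + y) (- b) - 1)).
    unfold Rpower; auto_derive; lra.
Qed.

Lemma is_lim_Rpower_neg (a : R) :
  0 < a -> is_lim (fun r => Rpower r (- a)) p_infty 0.
Proof.
  intros Ha; unfold Rpower.
  apply (is_lim_comp exp _ _ _ m_infty); [apply is_lim_exp_m| |].
  - evar_last; [apply is_lim_scal_l, is_lim_ln_p|].
    (* The product of - a and [p_infty] in [Rbar] is decided by the sign of - a. *)
    simpl; destruct (Rle_dec 0 (- a)); [exfalso; lra|reflexivity].
  - now exists 0.
Qed.

Lemma profile_vanishes_at_infinity : is_lim profile p_infty 0.
Proof.
  pose proof b_pos.
  apply (is_lim_ext_loc (fun r =>
    c * (1 + (Rpower (1 + / (r ^ 2) ^ N) (- b) - 1)) * Rpower r (- (2 * b)))).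
  - exists 0; intros r Hr; symmetry; now apply profile_decay.
  - evar_last.
    { apply is_lim_mult; [|apply is_lim_Rpower_neg; lra|].
      - apply is_lim_scal_l, is_lim_plus'; [apply is_lim_const|].
        apply profile_decay_remainder.
      - exact I. }
    simpl; f_equal; ring.
Qed.

(** * Bell shape *)

Lemma profile_bell_shaped : bell_shaped profile.
Proof.
  pose proof INR_m_ge1; pose proof b_mul_2m as Hb; pose proof b_pos as Hb0.
  assert (HN : INR N <> 0) by (rewrite INR_N; lra).
  split; [|split; [|split]].
  - exists 1; split; [lra|]; pose proof (profile_pos 1); lra.
  - unfold profile; ring.
  - exists profile_factor; split; [exact profile_factor_smooth|split].
    + pose proof (profile_factor_pos 0); lra.
    + reflexivity.
  (* The positive root of b t^N = 1, where the slope vanishes; the maximum is at r = sqrt t0. *)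
  - set (t0 := Rpower (INR (2 * m)) (/ INR N)).
    assert (Ht0 : 0 < t0) by apply exp_pos.
    assert (Et0 : b * t0 ^ N = 1).
    { unfold t0; rewrite <- Rpower_pow by apply exp_pos.
      rewrite Rpower_mult, Rinv_l, Rpower_1; auto.
      rewrite INR_2m; lra. }
    assert (Hr0 : 0 < sqrt t0) by now apply sqrt_lt_R0.
    assert (Hsq : sqrt t0 ^ 2 = t0) by (apply pow2_sqrt; lra).
    (* A positive factor is split off, so that the sign of the derivative is that of 1 - b t^N,
       which decreases in t. *)
    assert (Hfactor : forall r, 0 < r -> exists k, 0 < k /\
              2 * r * profile_slope (r ^ 2) = k * (1 - b * (r ^ 2) ^ N)).
    { intros r Hr; exists (2 * r * profile_factor (r ^ 2) / (1 + (r ^ 2) ^ N)).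
      pose proof (one_plus_pow_pos (r ^ 2) (pow2_ge_0 r)).
      split; [|unfold profile_slope; field; lra].
      apply Rdiv_lt_0_compat; [|assumption].
      apply Rmult_lt_0_compat; [lra|apply profile_factor_pos]. }
    assert (Hbefore : forall r, 0 < r -> r < sqrt t0 ->
              0 < 2 * r * profile_slope (r ^ 2)).
    { intros r H1 H2; destruct (Hfactor r H1) as [k [Hk ->]].
      assert (H3 : r ^ 2 < t0) by (rewrite <- Hsq; apply pow_S_lt_compat; lra).
      assert (H4 : (r ^ 2) ^ N < t0 ^ N)
        by (apply pow_S_lt_compat; [apply pow2_ge_0|exact H3]).
      pose proof (Rmult_lt_compat_l b _ _ Hb0 H4).
      apply Rmult_lt_0_compat; lra. }
    assert (Hafter : forall r, sqrt t0 < r ->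
              2 * r * profile_slope (r ^ 2) < 0).
    { intros r H2; destruct (Hfactor r) as [k [Hk ->]]; [lra|].
      assert (H3 : t0 < r ^ 2) by (rewrite <- Hsq; apply pow_S_lt_compat; lra).
      assert (H4 : t0 ^ N < (r ^ 2) ^ N) by (apply pow_S_lt_compat; lra).
      pose proof (Rmult_lt_compat_l b _ _ Hb0 H4); nra. }
    exists (sqrt t0); split; [|split; [|split]].
    + split.
      * split; [exact Hr0|].
        rewrite (is_derive_unique _ _ _ (is_derive_profile _)), Hsq.
        unfold profile_slope; rewrite Et0; unfold Rdiv; ring.
      * intros r [Hr HD].
        rewrite (is_derive_unique _ _ _ (is_derive_profile _)) in HD.
        destruct (Rtotal_order r (sqrt t0)) as [Hlt|[Heq|Hgt]].
        -- pose proof (Hbefore r Hr Hlt); lra.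
        -- now symmetry.
        -- pose proof (Hafter r Hgt); lra.
    + intros r s Hr Hrs Hs.
      (* The mean value point is strictly interior, so the zeros of the derivative at 0 and
         [sqrt t0] do not spoil strict monotonicity. *)
      destruct (MVT_cor2 profile (fun x => 2 * x * profile_slope (x ^ 2)) r s Hrs)
        as [x [Hx Hrx]].
      { intros x _; apply is_derive_Reals, is_derive_profile. }
      assert (Hp : 0 < 2 * x * profile_slope (x ^ 2)) by (apply Hbefore; lra).
      pose proof (Rmult_lt_0_compat _ (s - r) Hp); lra.
    + intros r s Hr Hrs.
      destruct (MVT_cor2 profile (fun x => 2 * x * profile_slope (x ^ 2)) r s Hrs)
        as [x [Hx Hrx]].
      { intros x _; apply is_derive_Reals, is_derive_profile. }
      assert (Hp : 2 * x * profile_slope (x ^ 2) < 0) by (apply Hafter; lra).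
      pose proof (Rmult_lt_compat_r (s - r) _ _ ltac:(lra) Hp); lra.
    + exact profile_vanishes_at_infinity.
Qed.

End Profile.

Theorem proposition1p1 (m : nat) (hm : (1 <= m)%nat)
    (gamma : R) (hgamma : gamma = 2 + 1 / INR m) :
  exists A : R, 0 < A /\
  exists psi : R -> R,
    solves_ode gamma A psi /\
    smooth_on nonneg_line psi /\
    (forall r : R, 0 <= r -> 0 <= psi r) /\
    bell_shaped psi /\
    self_similar_decay gamma psi.
Proof.
  pose proof (INR_m_ge1 m hm) as Hm.
  (* This is A = (m+1) B for the value B = 4 (m+1) / sqrt N, with [N] unfolded. *)
  exists (4 * (INR m + 1) ^ 2 / sqrt (INR (S (2 * m)))); split.
  { apply Rdiv_lt_0_compat.
    - apply Rmult_lt_0_compat; [lra|apply pow_lt; lra].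
    - apply sqrt_lt_R0, (lt_INR 0); lia. }
  exists (profile m); split; [now apply profile_solves_ode|].
  split; [apply profile_smooth|split; [|split]].
  - intros r Hr; apply Rmult_le_pos; [apply pow2_ge_0|].
    apply Rlt_le, profile_factor_pos.
  - now apply profile_bell_shaped.
  - eexists; split; [apply (c_pos m)|].
    eexists; split; [apply (profile_decay_remainder m hm)|].
    intros r Hr; rewrite (profile_decay m hm r Hr).
    (* The exponents agree because 2b = 1/m = gamma - 2. *)
    f_equal; f_equal; rewrite (b_eq m), hgamma; field; lra.
Qed.
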